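(* Let $(A_q)_{q=1}^{\infty}$ be a strictly decreasing sequence of sets of integers that is uniformly bounded below. Then $\mathcal{H}(A_q) = \mathbf{N}$.
   Context: $\mathbf{N} = \{1,2,3,\ldots\}$ is the set of positive integers. For a set $A$ of integers and $h \in \mathbf{N}$, the $h$-fold sumset $hA$ is the set of all sums $a_1+\cdots+a_h$ of $h$ not necessarily distinct elements of $A$ (so $h\emptyset = \emptyset$). A sequence of sets $(A_q)_{q=1}^{\infty}$ is strictly decreasing if $A_{q+1} \subseteq A_q$ and $A_{q+1} \neq A_q$ for all $q \in \mathbf{N}$. A sequence $(A_q)_{q=1}^{\infty}$ of sets of integers is uniformly bounded below if there is an integer $m_0$ such that $\min A_q \geq m_0$ for all $q \in \mathbf{N}$. For a strictly decreasing sequence $(A_q)_{q=1}^{\infty}$ of sets of integers, let $A = \bigcap_{q=1}^{\infty} A_q$ and define $\mathcal{H}(A_q) = \{h \in \mathbf{N} : hA = \bigcap_{q=1}^{\infty} hA_q\}$; this set depends on the whole sequence. *)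

(* Defs.v *)
From mathcomp Require Import all_boot all_order all_algebra.
From mathcomp Require Import classical_sets.

Set Implicit Arguments.
Unset Strict Implicit.
Unset Printing Implicit Defensive.

Local Open Scope classical_set_scope.
Local Open Scope ring_scope.

Definition posnat : set nat := [set n | (0 < n)%N].

(* Only the values h >= 1 matter; sumset 0 A is {0}. *)
Definition sumset (h : nat) (A : set int) : set int :=
  [set x | exists a : 'I_h -> int, (forall i, A (a i)) /\ x = \sum_(i < h) a i].

(* A sequence (A_q)_{q >= 1} is a function on nat whose value at 0 is ignored. *)
Definition strictly_decreasing (A : nat -> set int) : Prop :=
  forall q, posnat q -> A q.+1 `<=` A q /\ A q.+1 <> A q.

Definition is_min (A : set int) (m : int) : Prop := A m /\ lbound A m.

Definition uniformly_bounded_below (A : nat -> set int) : Prop :=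
  exists m0 : int, forall q, posnat q -> exists2 m, is_min (A q) m & m0 <= m.

Definition calH (A : nat -> set int) : set nat :=
  [set h | posnat h /\
    sumset h (\bigcap_(q in posnat) A q) = \bigcap_(q in posnat) sumset h (A q)].

(* Main.v *)
Require Import Defs.
From mathcomp Require Import all_boot all_order all_algebra.
From mathcomp Require Import boolp classical_sets.

Set Implicit Arguments.
Unset Strict Implicit.
Unset Printing Implicit Defensive.

Import Order.TTheory GRing.Theory Num.Theory.

Local Open Scope classical_set_scope.
Local Open Scope ring_scope.

(** Fix [h] and let [x] lie in every [h]-fold sumset.  A summand of a
    representation of [x] as a sum of [h] elements, all at least [m0], lies in
    the interval from [m0] to [x - (h - 1) m0] ([summand_le]), and this interval
    does not depend on [q].  A decreasing sequence of sets restricted to a finite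
    interval is eventually constant, hence eventually equal to its intersection
    there ([capture_interval]).  So any representation of [x] at a late enough
    stage already has all its summands in the intersection.  The other
    inclusion is monotonicity of sumsets. *)

Lemma sumsetS h (A B : set int) : A `<=` B -> sumset h A `<=` sumset h B.
Proof. by move=> AB x [a [Aa ->]]; exists a; split=> // i; exact: AB. Qed.

Lemma decreasing_le (A : nat -> set int) :
  (forall q, posnat q -> A q.+1 `<=` A q) ->
  forall p q, posnat p -> (p <= q)%N -> A q `<=` A p.
Proof.
move=> decA p q p_gt0 /subnKC <-; elim: (q - p)%N => [|d IHd].
  by rewrite addn0.
rewrite addnS; apply: subset_trans IHd; apply: decA.
exact: leq_trans p_gt0 (leq_addr d p).
Qed.

(** Each of the [n] points of the interval starting at [m] either belongs to
    the intersection or has been dropped by some stage; the largest of these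
    finitely many stages works for the whole interval. *)
Lemma capture_interval (A : nat -> set int) (m : int) (n : nat) :
  (forall q, posnat q -> A q.+1 `<=` A q) ->
  exists2 q, posnat q & forall k : nat, (k < n)%N ->
    A q (m + k%:Z) -> (\bigcap_(p in posnat) A p) (m + k%:Z).
Proof.
move=> decA; elim: n => [|n [q q_gt0 IHq]]; first by exists 1%N.
have [capAn|/existsNP[p /not_implyP[p_gt0 nApn]]] :=
  pselect ((\bigcap_(p in posnat) A p) (m + n%:Z)).
  exists q => // k; rewrite ltnS leq_eqVlt => /orP[/eqP-> //|]; exact: IHq.
have q_le : (q <= maxn q p)%N := leq_maxl q p.
have p_le : (p <= maxn q p)%N := leq_maxr q p.
exists (maxn q p); first exact: leq_trans q_gt0 q_le.
move=> k; rewrite ltnS leq_eqVlt => /orP[/eqP->|lt_kn] Ak.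
  by case: nApn; exact: decreasing_le p_le _ Ak.
by apply: IHq => //; exact: decreasing_le q_le _ Ak.
Qed.

(** Subtracting [m] from every summand leaves nonnegative terms, none of which
    exceeds their sum. *)
Lemma summand_le h (a : 'I_h -> int) (m : int) :
  (forall i, m <= a i) ->
  forall i, a i - m <= \sum_(j < h) a j - m *+ h.
Proof.
move=> m_le i.
have -> : \sum_(j < h) a j - m *+ h = \sum_(j < h) (a j - m).
  by rewrite sumrB sumr_const card_ord.
rewrite (bigD1 i) //= lerDl; apply: sumr_ge0 => j _.
by rewrite subr_ge0.
Qed.

Theorem theorem3 (A : nat -> set int)
  (hdec : strictly_decreasing A) (hbdd : uniformly_bounded_below A) :
  calH A = posnat.
Proof.
have decA q : posnat q -> A q.+1 `<=` A q by move=> /hdec[].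
case: hbdd => m0 bddA.
have m0_le q z : posnat q -> A q z -> m0 <= z.
  by move=> /bddA[m [_ m_lb] m0m] /m_lb; exact: le_trans.
apply/seteqP; split=> [h [] //|h h_gt0]; split=> //.
apply/seteqP; split=> [x capx q q_gt0|x capx].
  by apply: sumsetS capx => z; exact.
have [q q_gt0 captured] := capture_interval m0 `|x - m0 *+ h|.+1 decA.
have [a [Aa x_def]] := capx q q_gt0.
exists a; split=> // i.
have a_ge j : m0 <= a j := m0_le _ _ q_gt0 (Aa j).
have k_ge0 : 0 <= a i - m0 by rewrite subr_ge0.
(* The offset of [a i] from [m0], as a natural number, indexes the interval. *)
have ai_def : a i = m0 + `|a i - m0|%N%:Z by rewrite gez0_abs // addrCA subrr addr0.
rewrite ai_def; apply: captured; last by rewrite -ai_def.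
have le_k : a i - m0 <= x - m0 *+ h by rewrite x_def summand_le.
by rewrite ltnS -lez_nat !gez0_abs // (le_trans k_ge0).
Qed.
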